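(* Let $(A,\cdot)$ be a pre-Malcev superalgebra. (i) Define, for all homogeneous $x,y\in A$, $[x,y]=x\cdot y-(-1)^{|x||y|}y\cdot x$. Then $(A,[\cdot,\cdot])$ is a Malcev superalgebra. (ii) For $x\in A$ let $L_x:A\to A$, $L_x(y)=x\cdot y$. Then $L:A\to gl(A)$, $x\mapsto L_x$, is a representation of the Malcev superalgebra $(A,[\cdot,\cdot])$, that is, for all homogeneous $x,y,z\in A$, $$L_{[[x,y],z]}=L_xL_yL_z-(-1)^{|z|(|x|+|y|)}L_zL_xL_y+(-1)^{|x|(|y|+|z|)}L_yL_{[z,x]}-(-1)^{|x|(|y|+|z|)}L_{[y,z]}L_x .$$
   Context: All vector spaces are finite dimensional over an algebraically closed field $\mathbb K$ of characteristic zero. A super vector space is a $\mathbb Z_2$-graded space $V=V_{\bar 0}\oplus V_{\bar 1}$; $|x|\in\{0,1\}$ is the parity of a homogeneous element $x$. $gl(V)$ is the $\mathbb Z_2$-graded space of linear endomorphisms of $V$. A pre-Malcev superalgebra is a super vector space $A=A_{\bar 0}\oplus A_{\bar 1}$ with a bilinear product $\cdot$ with $A_\alpha\cdot A_\beta\subseteq A_{\alpha+\beta}$ such that, for all homogeneous $x,y,z,t$, writing $[x,y]=x\cdot y-(-1)^{|x||y|}y\cdot x$, $$(-1)^{|x|(|y|+|z|)}[y,z]\cdot(x\cdot t)+[[x,y],z]\cdot t+(-1)^{|x||y|}y\cdot([x,z]\cdot t)-x\cdot(y\cdot(z\cdot t))+(-1)^{|z|(|x|+|y|)}z\cdot(x\cdot(y\cdot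 t))=0.$$ A Malcev superalgebra is a super vector space $A$ with a bilinear map $[\cdot,\cdot]:A\times A\to A$, $[A_\alpha,A_\beta]\subseteq A_{\alpha+\beta}$, such that for all homogeneous $x,y,z,t$: $[x,y]=-(-1)^{|x||y|}[y,x]$ and $$(-1)^{|y||z|}[[x,z],[y,t]]=[[[x,y],z],t]+(-1)^{|x|(|y|+|z|+|t|)}[[[y,z],t],x]+(-1)^{(|x|+|y|)(|z|+|t|)}[[[z,t],x],y]+(-1)^{|t|(|x|+|y|+|z|)}[[[t,x],y],z].$$ A representation of a Malcev superalgebra $A$ on a super vector space $V$ is an even linear map $\rho:A\to gl(V)$ such that, for all homogeneous $x,y,z\in A$, $$\rho([[x,y],z])=\rho(x)\rho(y)\rho(z)-(-1)^{|z|(|x|+|y|)}\rho(z)\rho(x)\rho(y)+(-1)^{|x|(|y|+|z|)}\rho(y)\rho([z,x])-(-1)^{|x|(|y|+|z|)}\rho([y,z])\rho(x).$$ *)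

(* Defs.v *)
From HB Require Import structures.
From mathcomp Require Import all_boot all_order all_algebra.

Set Implicit Arguments.
Unset Strict Implicit.
Unset Printing Implicit Defensive.

Import GRing.Theory.
Local Open Scope ring_scope.

(* Z/2 is [bool] with addition [(+)] ([addb]); [false] is even, [true] is odd.
   In a sign such as [(-1) ^+ (a * (b + c))] parities are coerced to nat. *)

Structure superVectType (K : fieldType) := SuperVectType {
  svect_sort :> vectType K;
  spart : bool -> {vspace svect_sort};
  spart_add : (spart false + spart true)%VS = fullv;
  spart_cap : (spart false :&: spart true)%VS = 0%VS
}.

Section SuperAlgebra.
Variable K : fieldType.
Implicit Types A V : superVectType K.

Definition shomog V (a : bool) (x : V) : V :=
  daddv_pi (spart V a) (spart V (~~ a)) x.

Definition gl_part V (a : bool) (f : 'End(V)) : Prop :=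
  forall b : bool, (f @: spart V b <= spart V (a (+) b))%VS.

Definition is_superproduct A (op : A -> A -> A) : Prop :=
  [/\ forall y : A, linear (op^~ y),
      forall x : A, linear (op x)
    & forall (a b : bool) (x y : A), x \in spart A a -> y \in spart A b ->
        op x y \in spart A (a (+) b)].

(* Bilinear extension of [x, y] = x . y - (-1)^(|x||y|) y . x, which is only
   given on homogeneous elements; see [supercommutatorE]. *)
Definition supercommutator A (mul : A -> A -> A) (x y : A) : A :=
  \sum_(a : bool) \sum_(b : bool)
    (mul (shomog a x) (shomog b y)
       - (-1) ^+ (a * b) *: mul (shomog b y) (shomog a x)).

Definition is_preMalcev A (mul : A -> A -> A) : Prop :=
  is_superproduct mul /\
  let br := supercommutator mul in
  forall (a b c d : bool) (x y z t : A),
    x \in spart A a -> y \in spart A b -> z \in spart A c -> t \in spart A d ->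
    (-1) ^+ (a * (b + c)) *: mul (br y z) (mul x t)
      + mul (br (br x y) z) t
      + (-1) ^+ (a * b) *: mul y (mul (br x z) t)
      - mul x (mul y (mul z t))
      + (-1) ^+ (c * (a + b)) *: mul z (mul x (mul y t)) = 0.

Definition is_Malcev A (br : A -> A -> A) : Prop :=
  [/\ is_superproduct br,
      forall (a b : bool) (x y : A), x \in spart A a -> y \in spart A b ->
        br x y = - ((-1) ^+ (a * b) *: br y x)
    & forall (a b c d : bool) (x y z t : A),
        x \in spart A a -> y \in spart A b ->
        z \in spart A c -> t \in spart A d ->
        (-1) ^+ (b * c) *: br (br x z) (br y t) =
          br (br (br x y) z) t
          + (-1) ^+ (a * (b + c + d)) *: br (br (br y z) t) x
          + (-1) ^+ ((a + b) * (c + d)) *: br (br (br z t) x) y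
          + (-1) ^+ (d * (a + b + c)) *: br (br (br t x) y) z].

Definition is_Malcev_repr A (br : A -> A -> A) V (rho : A -> 'End(V)) : Prop :=
  [/\ linear rho,
      forall (a : bool) (x : A), x \in spart A a -> gl_part a (rho x)
    & forall (a b c : bool) (x y z : A),
        x \in spart A a -> y \in spart A b -> z \in spart A c ->
        rho (br (br x y) z) =
          (rho x \o rho y \o rho z)%VF
          - (-1) ^+ (c * (a + b)) *: (rho z \o rho x \o rho y)%VF
          + (-1) ^+ (a * (b + c)) *: (rho y \o rho (br z x))%VF
          - (-1) ^+ (a * (b + c)) *: (rho (br y z) \o rho x)%VF].

(* [linfun] is only meaningful on linear maps; see [left_mulE]. *)
Definition left_mul A (mul : A -> A -> A) (x : A) : 'End(A) := linfun (mul x).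

Lemma spart_cap_opp V (a : bool) : (spart V a :&: spart V (~~ a))%VS = 0%VS.
Proof. by case: a; rewrite /= ?(capvC (spart V true)) spart_cap. Qed.

Lemma shomog_id V (a : bool) (x : V) : x \in spart V a -> shomog a x = x.
Proof. exact/daddv_pi_id/spart_cap_opp. Qed.

Lemma shomog_opp V (a : bool) (x : V) : x \in spart V a -> shomog (~~ a) x = 0.
Proof.
move=> xa; have xs : x \in (spart V (~~ a) + spart V a)%VS.
  by rewrite -[x]add0r memv_add ?mem0v.
have dis : (spart V (~~ a) :&: spart V a)%VS = 0%VS.
  by rewrite capvC spart_cap_opp.
have := daddv_pi_add dis xs; rewrite /shomog negbK.
rewrite (daddv_pi_id (spart_cap_opp V a) xa) => /eqP.
by rewrite -subr_eq0 addrK => /eqP.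
Qed.

Lemma supercommutatorE A (mul : A -> A -> A) (a b : bool) (x y : A) :
  is_superproduct mul -> x \in spart A a -> y \in spart A b ->
  supercommutator mul x y = mul x y - (-1) ^+ (a * b) *: mul y x.
Proof.
case=> linl linr _ xa yb.
have mul0 u : mul 0 u = 0 by have := linl u (-1) 0 0; rewrite scaler0 addr0 scaleN1r addNr.
have mulr_0 u : mul u 0 = 0 by have := linr u (-1) 0 0; rewrite scaler0 addr0 scaleN1r addNr.
rewrite /supercommutator (bigD1 a) //= (bigD1 b) //= !shomog_id //.
rewrite big1 => [|c ncb]; last first.
  have -> : c = ~~ b by case: (c) (b) ncb => [] [].
  by rewrite (shomog_opp yb) mul0 mulr_0 scaler0 subr0.
rewrite addr0 big1 ?addr0 // => c nca.
have -> : c = ~~ a by case: (c) (a) nca => [] [].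
by rewrite big1 // => e _; rewrite (shomog_opp xa) mul0 mulr_0 scaler0 subr0.
Qed.

Lemma left_mulE A (mul : A -> A -> A) (x y : A) :
  is_superproduct mul -> left_mul mul x y = mul x y.
Proof.
case=> _ linr _.
pose f := HB.pack_for {linear A -> A} (mul x)
  (GRing.isLinear.Build K A A _ (mul x) (linr x)).
exact: (lfunE f y).
Qed.

End SuperAlgebra.

(* Main.v *)
Require Import Defs.
From mathcomp Require Import all_boot all_order all_algebra.
From mathcomp Require Import ring.
Import GRing.Theory.
Local Open Scope ring_scope.

(** Part (ii) is the defining identity of a pre-Malcev superalgebra, read as an
    identity between operators applied to [t], once [[x, z]] has been replaced
    by a multiple of [[z, x]].

    For part (i), forget the signs at first.  Exchanging the first two
    arguments of the pre-Malcev identity gives [bracket_bracket_mulE],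
      [[x, y], z] t = [x, z](y t) + x([y, z] t) - y(x(z t)) + z(y(x t)),
    and subtracting t [[x, y], z] gives
      [[[x, y], z], t] = [x, z](y t)
        + (x([y, z] t) - t([x, y] z))
        + (z(y(x t)) - t(z(y x))) + (t(z(x y)) - y(x(z t))).
    In each of the three parentheses the two terms differ by a cyclic shift of
    (x, y, z, t), so the parentheses vanish in the sum over the four cyclic
    shifts.  What remains is
      [x, z](y t) + [y, t](z x) + [z, x](t y) + [t, y](x z),
    which is [x, z][y, t] - [y, t][x, z] = [[x, z], [y, t]].  The order of the
    first two arguments matters: in the identity as given, the terms
    [y, z](x t) would pair adjacent letters of the cycle and would not recombine
    into [[x, z], [y, t]].

    Every sign is the one produced by reordering odd letters, so that the
    computation carries over; the signs are compared for each of the sixteen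
    choices of parities. *)

Section VectorIdentities.
Variables (K : fieldType) (V : vectType K).

(** Reduces an identity of vectors to one of scalars, where the commutative
    ring normalizer applies.  Linearity of the functional is spelled out as
    three equations, by which rewriting is much faster than by the generic
    lemmas on linear maps. *)
Lemma eq_by_coordinates (u v : V) :
  (forall f : V -> K, {morph f : x y / x + y} -> {morph f : x / - x} ->
     (forall k x, f (k *: x) = k * f x) -> f u = f v) ->
  u = v.
Proof.
move=> fuv; rewrite (coord_vbasis (memvf u)) (coord_vbasis (memvf v)).
apply: eq_bigr => i _; congr (_ *: _).
apply: fuv; [exact: linearD | exact: linearN | move=> k x; exact: linearZ].
Qed.

Lemma eq_modulo_relation (k : K) (w u v : V) : w = 0 -> u = v + k *: w -> u = v.
Proof. by move=> ->; rewrite scaler0 addr0. Qed.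

End VectorIdentities.

(** Proves an identity of vectors that is linear in its non-scalar atoms. *)
Ltac linear_combination_of_vectors :=
  let f := fresh "f" in
  let fD := fresh "fD" in let fN := fresh "fN" in let fZ := fresh "fZ" in
  apply: eq_by_coordinates => f fD fN fZ; rewrite ?(fD, fN, fZ);
  ring.

Section Superproducts.
Set Implicit Arguments.
Unset Strict Implicit.
Variables (K : fieldType) (A : superVectType K) (mul : A -> A -> A).
Hypothesis mulP : is_superproduct mul.
Local Notation br := (supercommutator mul).

Lemma superproduct_linearl y k u v : mul (k *: u + v) y = k *: mul u y + mul v y.
Proof. by case: mulP => linl _ _; apply: linl. Qed.

Lemma superproduct_linearr x k u v : mul x (k *: u + v) = k *: mul x u + mul x v.
Proof. by case: mulP => _ linr _; apply: linr. Qed.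

Lemma superproduct0l y : mul 0 y = 0.
Proof.
by have := superproduct_linearl y (-1) 0 0; rewrite scaler0 addr0 scaleN1r addNr.
Qed.

Lemma superproduct0r x : mul x 0 = 0.
Proof.
by have := superproduct_linearr x (-1) 0 0; rewrite scaler0 addr0 scaleN1r addNr.
Qed.

Lemma superproductZl y k u : mul (k *: u) y = k *: mul u y.
Proof. by rewrite -[k *: u]addr0 superproduct_linearl superproduct0l addr0. Qed.

Lemma superproductZr x k u : mul x (k *: u) = k *: mul x u.
Proof. by rewrite -[k *: u]addr0 superproduct_linearr superproduct0r addr0. Qed.

Lemma superproductNl y u : mul (- u) y = - mul u y.
Proof. by rewrite -scaleN1r superproductZl scaleN1r. Qed.

Lemma superproductNr x u : mul x (- u) = - mul x u.
Proof. by rewrite -scaleN1r superproductZr scaleN1r. Qed.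

Lemma superproductDl y u v : mul (u + v) y = mul u y + mul v y.
Proof. by rewrite -{1}[u]scale1r superproduct_linearl scale1r. Qed.

Lemma superproductDr x u v : mul x (u + v) = mul x u + mul x v.
Proof. by rewrite -{1}[u]scale1r superproduct_linearr scale1r. Qed.

Definition superproduct_linE :=
  (superproductDl, superproductDr, superproductNl, superproductNr,
   superproductZl, superproductZr).

Lemma superproduct_part a b x y :
  x \in spart A a -> y \in spart A b -> mul x y \in spart A (a (+) b).
Proof. by case: mulP => _ _; apply. Qed.

Lemma supercommutator_part a b x y :
  x \in spart A a -> y \in spart A b -> br x y \in spart A (a (+) b).
Proof.
move=> xa yb; rewrite (supercommutatorE mulP xa yb).
apply: memvB; first exact: superproduct_part.
by apply: memvZ; rewrite addbC; apply: superproduct_part.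
Qed.

Lemma supercommutator_superproduct : is_superproduct br.
Proof.
split; last exact: supercommutator_part.
- move=> y k u v; rewrite /supercommutator !big_bool /shomog /=.
  rewrite !linearP /= !superproduct_linE.
  by linear_combination_of_vectors.
- move=> x k u v; rewrite /supercommutator !big_bool /shomog /=.
  rewrite !linearP /= !superproduct_linE.
  by linear_combination_of_vectors.
Qed.

Lemma supercommutator_antisym a b x y :
  x \in spart A a -> y \in spart A b -> br x y = - ((-1) ^+ (a * b) *: br y x).
Proof.
move=> xa yb; rewrite (supercommutatorE mulP xa yb) (supercommutatorE mulP yb xa).
by case: a b {xa yb} => [] [] /=; linear_combination_of_vectors.
Qed.

End Superproducts.

Section PreMalcev.
Set Implicit Arguments.
Unset Strict Implicit.
Variables (K : fieldType) (A : superVectType K) (mul : A -> A -> A).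
Hypothesis preMalcevA : is_preMalcev mul.
Local Notation br := (supercommutator mul).

Let mulP : is_superproduct mul. Proof. by case: preMalcevA. Qed.

(** The pre-Malcev identity with [x] and [y] exchanged, multiplied by
    the sign that restores [[x, y]]. *)
Lemma bracket_bracket_mulE a b c d x y z t :
  x \in spart A a -> y \in spart A b -> z \in spart A c -> t \in spart A d ->
  mul (br (br x y) z) t =
    (-1) ^+ (b * c) *: mul (br x z) (mul y t) + mul x (mul (br y z) t)
    - (-1) ^+ (a * b) *: mul y (mul x (mul z t))
    + (-1) ^+ (a * b + a * c + b * c) *: mul z (mul y (mul x t)).
Proof.
move=> xa yb zc td; have [_ /(_ b a c d y x z t yb xa zc td) /= H] := preMalcevA.
have brP := supercommutator_superproduct mulP.
rewrite (supercommutator_antisym mulP xa yb).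
rewrite !(superproduct_linE brP) !(superproduct_linE mulP).
apply: (eq_modulo_relation _ _ (- (-1) ^+ (a * b)) _ _ _ H); clear H.
by case: a b c {xa yb zc} => [] [] [] /=; linear_combination_of_vectors.
Qed.

(** The terms after the first one form three pairs; up to sign, the two terms
    of a pair are exchanged by a cyclic shift of [x, y, z, t]. *)
Lemma bracket3E a b c d x y z t :
  x \in spart A a -> y \in spart A b -> z \in spart A c -> t \in spart A d ->
  br (br (br x y) z) t =
    (-1) ^+ (b * c) *: mul (br x z) (mul y t)
    + (mul x (mul (br y z) t)
       - (-1) ^+ (d * (a + b + c)) *: mul t (mul (br x y) z))
    + ((-1) ^+ (a * b + a * c + b * c) *: mul z (mul y (mul x t))
       - (-1) ^+ (d * (a + b + c) + c * (a + b) + a * b)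
           *: mul t (mul z (mul y x)))
    + ((-1) ^+ (d * (a + b + c) + c * (a + b)) *: mul t (mul z (mul x y))
       - (-1) ^+ (a * b) *: mul y (mul x (mul z t))).
Proof.
move=> xa yb zc td.
have xy := supercommutator_part mulP xa yb.
have xyz := supercommutator_part mulP xy zc.
rewrite (supercommutatorE mulP xyz td) (bracket_bracket_mulE xa yb zc td).
rewrite (supercommutatorE mulP xy zc) !(superproduct_linE mulP).
rewrite [in mul z (br x y)](supercommutatorE mulP xa yb).
rewrite !(superproduct_linE mulP).
by case: a b c d {xa yb zc td xy xyz} => [] [] [] [] /=;
  linear_combination_of_vectors.
Qed.

End PreMalcev.

Lemma supercommutator_Malcev (K : fieldType) (A : superVectType K)
  (mul : A -> A -> A) : is_preMalcev mul -> is_Malcev (supercommutator mul).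
Proof.
move=> preMalcevA; have [mulP _] := preMalcevA.
split; first exact: supercommutator_superproduct.
  exact: supercommutator_antisym.
move=> a b c d x y z t xa yb zc td.
have xz := supercommutator_part mulP xa zc.
have yt := supercommutator_part mulP yb td.
rewrite (bracket3E preMalcevA xa yb zc td).
rewrite (bracket3E preMalcevA yb zc td xa).
rewrite (bracket3E preMalcevA zc td xa yb).
rewrite (bracket3E preMalcevA td xa yb zc).
rewrite (supercommutatorE mulP xz yt).
(* Only the right factor of each product is expanded, so that the brackets of
   opposite letters of the cycle match the first terms given by [bracket3E]. *)
rewrite [in mul _ (supercommutator mul y t)](supercommutatorE mulP yb td).
rewrite [in mul _ (supercommutator mul x z)](supercommutatorE mulP xa zc).
rewrite (supercommutator_antisym mulP zc xa).
rewrite (supercommutator_antisym mulP td yb).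
rewrite !(superproduct_linE mulP).
by case: a b c d {xa yb zc td xz yt} => [] [] [] [] /=;
  linear_combination_of_vectors.
Qed.

Lemma left_mul_Malcev_repr (K : fieldType) (A : superVectType K)
  (mul : A -> A -> A) :
  is_preMalcev mul -> is_Malcev_repr (supercommutator mul) (left_mul mul).
Proof.
move=> [mulP preMalcevA]; split.
- move=> k u v; apply/lfunP => w; rewrite add_lfunE scale_lfunE !left_mulE //.
  exact: superproduct_linearl.
- move=> a x xa b; apply/subvP => _ /memv_imgP[u ub ->].
  by rewrite left_mulE //; apply: superproduct_part.
move=> a b c x y z xa yb zc; apply/lfunP => t.
rewrite !(add_lfunE, opp_lfunE, scale_lfunE, comp_lfunE) !left_mulE //.
(* The identity is linear in [t]; it suffices to treat the two parts. *)
have [t0 t0P [t1 t1P ->]] : exists2 t0, t0 \in spart A false &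
    exists2 t1, t1 \in spart A true & t = t0 + t1.
  have /memv_addP[t0 t0P [t1 t1P tE]] : t \in (spart A false + spart A true)%VS.
    by rewrite spart_add memvf.
  by exists t0 => //; exists t1.
have H0 := preMalcevA _ _ _ _ _ _ _ _ xa yb zc t0P.
have H1 := preMalcevA _ _ _ _ _ _ _ _ xa yb zc t1P.
apply: (eq_modulo_relation _ _ 1 _ _ _ H0).
apply: (eq_modulo_relation _ _ 1 _ _ _ H1) => /=; clear H0 H1.
rewrite (supercommutator_antisym mulP xa zc).
rewrite !(superproduct_linE mulP).
by case: a b c {xa yb zc} => [] [] [] /=; linear_combination_of_vectors.
Qed.

Theorem theorem3p1 (K : closedFieldType) (charK0 : [pchar K] =i pred0)
  (A : superVectType K) (mul : A -> A -> A) (preMalcevA : is_preMalcev mul) :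
  is_Malcev (supercommutator mul) /\
  is_Malcev_repr (supercommutator mul) (left_mul mul).
Proof.
split; [exact: supercommutator_Malcev | exact: left_mul_Malcev_repr].
Qed.
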